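(* Let $X$ be a simplicial set with $|X|$ contractible and let $G$ be a filtered topological group. (1) If $A,B,C$ are local lattice higher gauge fields on $X$ with gauge group $G$, and $u:A\rightsquigarrow B$, $v:B\rightsquigarrow C$ are local gauge transformations, then the map $u\odot v:\rho(|X|)\to\rho(G)$ given by $(u\odot v)_n(\langle a\rangle)=u_n(\langle a\rangle)\odot v_n(\langle a\rangle)$ for every $\langle a\rangle\in\rho(|X|)_n$ is a local gauge transformation $A\rightsquigarrow C$. (2) For every local lattice higher gauge field $A$ on $X$ with gauge group $G$, the constant map $\mathbf{1}:\rho(|X|)\to\rho(G)$, sending every homotopy cube to the constant homotopy cube on the identity element $1$ of $G_0$, is a local gauge transformation $\mathbf{1}:A\rightsquigarrow A$. (3) For every local gauge transformation $u:A\rightsquigarrow B$, the map $u^{-1}$ given by $(u^{-1})_n(\langle a\rangle)=u_n(\langle a\rangle)^{-1}$ (inverse with respect to the internal product $\odot$ of $\rho(G)$) is a local gauge transformation $u^{-1}:B\rightsquigarrow A$ satisfying $u\odot u^{-1}=\mathbf{1}=u^{-1}\odot u$. Consequently, the local lattice higher gauge fields on $X$ with gauge group $G$ (as objects), with the local gauge transformations as morphisms and with the composite of $u:A\rightsquigarrow B$ and $v:B\rightsquigarrow C$ being $u\odot v$, form a groupoid.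
   Context: **$\omega$-groupoids.** A cubical set with connections $K$ consists of sets $K_k$ ($k\ge 0$), faces $\partial_i^\alpha:K_k\to K_{k-1}$ and degeneracies $\epsilon_i:K_{k-1}\to K_k$ ($0\le i\le k-1$, $\alpha\in\{0,1\}$), and connections $\Gamma_i$ raising dimension by one, satisfying the usual cubical and connection relations. An $\omega$-groupoid (in the sense of Brown–Higgins) is such a $K$ with, for each $k\ge1$ and $0\le i\le k-1$, a partial composition $a+_ib$ on $K_k$ (defined when $\partial_i^1a=\partial_i^0b$) and inversion $-_i$, each making $K_k$ a groupoid over $K_{k-1}$ with identities $\epsilon_i$, compatible with faces, degeneracies and connections and satisfying the interchange laws. Morphisms preserve all structure; the category is $\omega\mathbf{Gpd}$, with terminal object $\mathbf{0}$. **Homotopy $\omega$-groupoid.** For a filtered space $Y$, $\rho(Y)$ is the $\omega$-groupoid whose $k$-cubes (homotopy cubes) are classes $\langle a\rangle$ of filtered maps $[0,1]^k\to Y$ (skeletal filtration on the cube) modulo filtered homotopy relative to vertices, with structure induced from precomposition and concatenation. The geometric realization $|X|$ has its skeletal filtration. A filtered topological group is a topological group $G$ with a filtration $G_0\subseteq G_1\subseteq\cdots$, $G=\bigcup_i G_i$, with each $G_i$ a subgroup of $G_{i+1}$; then $\rho(G)$ is a group internal to $\omega\mathbf{Gpd}$ with product $\odot$ and inverse $(\_)^{-1}$ induced by pointwise operations. **Gauge fields.** For an $\omega$-groupoid $K$, $P^1K$ is the $\omega$-groupoid with $P^1K_m=K_{m+1}$ whose structure maps in direction $i$ are those of $K$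 in direction $i+1$; the pair $(P^1K,K)$, also written $P^1K$, is a groupoid internal to $\omega\mathbf{Gpd}$ with source $s=\partial_0^0$, target $t=\partial_0^1$, unit $\epsilon_0$, composition $+_0$, inverse $-_0$. For an internal group $K$, $BK=(K,\mathbf{0})$ is its delooping internal groupoid. A local lattice higher gauge field on $X$ with gauge group $G$ is a morphism of internal groupoids $A=(A^1,A^0):P^1\rho(|X|)\to B\rho(G)$. A local gauge transformation $u:A\rightsquigarrow B$ is a morphism $u:\rho(|X|)\to\rho(G)$ in $\omega\mathbf{Gpd}$ such that for every $n\ge1$ and every $\langle a\rangle\in\rho(|X|)_n=P^1\rho(|X|)_{n-1}$, $$u_{n-1}(s\langle a\rangle)\odot A^1_{n-1}(\langle a\rangle)\odot u_{n-1}(t\langle a\rangle)^{-1}=B^1_{n-1}(\langle a\rangle).$$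
   Formalization: The composite of u:A⇝B and v:B⇝C is taken to be v⊙u instead of u⊙v, in part (1) and in the final groupoid claim: the displayed gauge condition gives C=(v⊙u)(s)⊙A⊙(v⊙u)(t)^{-1}, so u⊙v fails for non-abelian G (e.g. X=Δ^1, G=SU(2)). *)

(* Defs.v *)
From HB Require Import structures.
From mathcomp Require Import all_boot all_order all_algebra.
From mathcomp Require Import all_classical all_reals all_analysis.
From Stdlib Require Import Relation_Operators Operators_Properties.

Set Implicit Arguments.
Unset Strict Implicit.
Unset Printing Implicit Defensive.

Import Order.TTheory GRing.Theory Num.Theory.
Import numFieldNormedType.Exports.

Local Open Scope classical_set_scope.
Local Open Scope ring_scope.
Local Open Scope quotient_scope.

(* Directions are counted from 0; the connections [conn i] are those with
   [conn i a (.., x_i, x_i.+1, ..) = a (.., max x_i x_i.+1, ..)] on singular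
   cubes. The partial composition in direction [i] is given by its graph:
   [pcomp i a b c] means that a +_i b is defined and equal to c. *)
Record omegaData := OmegaData {
  cell : nat -> Type;
  face : forall k, 'I_k.+1 -> bool -> cell k.+1 -> cell k;
  degen : forall k, 'I_k.+1 -> cell k -> cell k.+1;
  conn : forall k, 'I_k -> cell k -> cell k.+1;
  pcomp : forall k, 'I_k -> cell k -> cell k -> cell k -> Prop;
  opp : forall k, 'I_k -> cell k -> cell k
}.
Arguments face {o k}.
Arguments degen {o k}.
Arguments conn {o k}.
Arguments pcomp {o k}.
Arguments opp {o k}.

(* [lift ord0 i] is i + 1 and [widen_ord (leqnSn _) i] is i, one dimension
   up. *)
Local Notation up := (lift ord0).
Local Notation wd := (widen_ord (leqnSn _)).

Record is_cubical (K : omegaData) : Prop := {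
  face_face : forall k (i j : 'I_k.+1) d e (x : cell K k.+2), (i <= j)%N ->
    face i d (face (up j) e x) = face j e (face (wd i) d x);
  degen_degen : forall k (i j : 'I_k.+1) (x : cell K k), (i <= j)%N ->
    degen (wd i) (degen j x) = degen (up j) (degen i x);
  face_degen_eq : forall k (i : 'I_k.+1) d (x : cell K k),
    face i d (degen i x) = x;
  face_degen_lt : forall k (i j : 'I_k.+1) d (x : cell K k.+1), (i <= j)%N ->
    face (wd i) d (degen (up j) x) = degen j (face i d x);
  face_degen_gt : forall k (i j : 'I_k.+1) d (x : cell K k.+1), (j <= i)%N ->
    face (up i) d (degen (wd j) x) = degen j (face i d x);
  conn_conn : forall k (i j : 'I_k) (x : cell K k), (i <= j)%N ->
    conn (wd i) (conn j x) = conn (up j) (conn i x);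
  conn_degen_eq : forall k (i : 'I_k.+1) (x : cell K k),
    conn i (degen i x) = degen (wd i) (degen i x);
  conn_degen_lt : forall k (i j : 'I_k) (x : cell K k), (i <= j)%N ->
    conn (wd i) (degen (up j) x) = degen (up (up j)) (conn i x);
  conn_degen_gt : forall k (i j : 'I_k) (x : cell K k), (j <= i)%N ->
    conn (up i) (degen (wd j) x) = degen (wd (wd j)) (conn i x);
  face_conn_0 : forall k (i : 'I_k) (x : cell K k),
    face (wd i) false (conn i x) = x /\ face (up i) false (conn i x) = x;
  face_conn_1 : forall k (i : 'I_k.+1) (x : cell K k.+1),
    face (wd i) true (conn i x) = degen i (face i true x) /\
    face (up i) true (conn i x) = degen i (face i true x);
  face_conn_lt : forall k (i : 'I_k.+1) (j : 'I_k) d (x : cell K k.+1),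
    (i <= j)%N -> face (wd i) d (conn (up j) x) = conn j (face i d x);
  face_conn_gt : forall k (i : 'I_k.+1) (j : 'I_k) d (x : cell K k.+1),
    (j < i)%N -> face (up i) d (conn (wd j) x) = conn j (face i d x)
}.

(* The index [lift j i] is i if i < j and i + 1 otherwise. That [rho Y] below
   satisfies these laws is a theorem of Brown and Higgins; it is not used
   here. *)
Record is_omegaGroupoid (K : omegaData) : Prop := {
  omega_cubical : is_cubical K;
  comp_def : forall k (i : 'I_k.+1) (a b : cell K k.+1),
    (exists c, pcomp i a b c) <-> face i true a = face i false b;
  comp_fun : forall k (i : 'I_k) (a b c c' : cell K k),
    pcomp i a b c -> pcomp i a b c' -> c = c';
  comp_assoc : forall k (i : 'I_k) (a b c ab bc abc : cell K k),
    pcomp i a b ab -> pcomp i b c bc -> pcomp i ab c abc -> pcomp i a bc abc;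
  comp_degenl : forall k (i : 'I_k.+1) (a : cell K k.+1),
    pcomp i (degen i (face i false a)) a a;
  comp_degenr : forall k (i : 'I_k.+1) (a : cell K k.+1),
    pcomp i a (degen i (face i true a)) a;
  comp_oppr : forall k (i : 'I_k.+1) (a : cell K k.+1),
    pcomp i a (opp i a) (degen i (face i false a));
  comp_oppl : forall k (i : 'I_k.+1) (a : cell K k.+1),
    pcomp i (opp i a) a (degen i (face i true a));
  face_comp_eq : forall k (i : 'I_k.+1) (a b c : cell K k.+1),
    pcomp i a b c -> face i false c = face i false a /\
                    face i true c = face i true b;
  face_comp_neq : forall k (j : 'I_k.+2) (i : 'I_k.+1) d (a b c : cell K k.+2),
    pcomp (lift j i) a b c -> pcomp i (face j d a) (face j d b) (face j d c);
  degen_comp : forall k (j : 'I_k.+1) (i : 'I_k) (a b c : cell K k),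
    pcomp i a b c -> pcomp (lift j i) (degen j a) (degen j b) (degen j c);
  conn_comp_neq : forall k (i j : 'I_k) (a b c : cell K k), i != j ->
    pcomp i a b c -> pcomp (lift (up j) i) (conn j a) (conn j b) (conn j c);
  conn_comp_eq : forall k (i : 'I_k) (a b c : cell K k), pcomp i a b c ->
    exists x y, [/\ pcomp (wd i) (conn i a) (degen (up i) b) x,
                    pcomp (wd i) (degen (wd i) b) (conn i b) y &
                    pcomp (up i) x y (conn i c)];
  interchange : forall k (i j : 'I_k) (a b c d ab cd ac bd x : cell K k),
    i != j ->
    pcomp i a b ab -> pcomp i c d cd -> pcomp j a c ac -> pcomp j b d bd ->
    pcomp j ab cd x -> pcomp i ac bd x
}.

(* Being a morphism of omega-groupoids depends only on the [omegaData] and not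
   on the laws, so morphisms are defined on data. *)
Record is_omegaHom (K L : omegaData)
    (f : forall k, cell K k -> cell L k) : Prop := {
  hom_face : forall k (i : 'I_k.+1) d (x : cell K k.+1),
    f k (face i d x) = face i d (f k.+1 x);
  hom_degen : forall k (i : 'I_k.+1) (x : cell K k),
    f k.+1 (degen i x) = degen i (f k x);
  hom_conn : forall k (i : 'I_k) (x : cell K k),
    f k.+1 (conn i x) = conn i (f k x);
  hom_comp : forall k (i : 'I_k) (a b c : cell K k),
    pcomp i a b c -> pcomp i (f k a) (f k b) (f k c);
  hom_opp : forall k (i : 'I_k) (x : cell K k),
    f k (opp i x) = opp i (f k x)
}.

Record omegaHom (K L : omegaData) := OmegaHom {
  hom_fun :> forall k, cell K k -> cell L k;
  hom_funP : is_omegaHom hom_fun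
}.

Definition omega_terminal : omegaData := {|
  cell := fun _ => unit;
  face := fun _ _ _ _ => tt;
  degen := fun _ _ _ => tt;
  conn := fun _ _ _ => tt;
  pcomp := fun _ _ _ _ _ => True;
  opp := fun _ _ _ => tt |}.

(* [icomp a b c]: the composite of a and b (with tgt a = src b) is c. *)
Record internalGpd := InternalGpd {
  ig_mor : omegaData;
  ig_ob : omegaData;
  src : forall k, cell ig_mor k -> cell ig_ob k;
  tgt : forall k, cell ig_mor k -> cell ig_ob k;
  iunit : forall k, cell ig_ob k -> cell ig_mor k;
  icomp : forall k, cell ig_mor k -> cell ig_mor k -> cell ig_mor k -> Prop;
  iinv : forall k, cell ig_mor k -> cell ig_mor k
}.
Arguments src {i k}.
Arguments tgt {i k}.
Arguments iunit {i k}.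
Arguments icomp {i k}.
Arguments iinv {i k}.

Record internalHom (C D : internalGpd) := InternalHom {
  hom_mor : omegaHom (ig_mor C) (ig_mor D);
  hom_ob : omegaHom (ig_ob C) (ig_ob D);
  hom_src : forall k (a : cell (ig_mor C) k),
    src (hom_mor k a) = hom_ob k (src a);
  hom_tgt : forall k (a : cell (ig_mor C) k),
    tgt (hom_mor k a) = hom_ob k (tgt a);
  hom_iunit : forall k (x : cell (ig_ob C) k),
    hom_mor k (iunit x) = iunit (hom_ob k x);
  hom_icomp : forall k (a b c : cell (ig_mor C) k),
    icomp a b c -> icomp (hom_mor k a) (hom_mor k b) (hom_mor k c);
  hom_iinv : forall k (a : cell (ig_mor C) k),
    hom_mor k (iinv a) = iinv (hom_mor k a)
}.

Definition omega_path (K : omegaData) : omegaData := {|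
  cell := fun k => cell K k.+1;
  face := fun k i d => face (up i) d;
  degen := fun k i => degen (up i);
  conn := fun k i => conn (up i);
  pcomp := fun k i => pcomp (up i);
  opp := fun k i => opp (up i) |}.

Definition P1 (K : omegaData) : internalGpd := {|
  ig_mor := omega_path K;
  ig_ob := K;
  src := fun k => @face K k ord0 false;
  tgt := fun k => @face K k ord0 true;
  iunit := fun k => @degen K k ord0;
  icomp := fun k => @pcomp K k.+1 ord0;
  iinv := fun k => @opp K k.+1 ord0 |}.

Record internalGroup := InternalGroup {
  igr_carrier :> omegaData;
  igr_one : forall k, cell igr_carrier k;
  igr_mul : forall k, cell igr_carrier k -> cell igr_carrier k ->
    cell igr_carrier k;
  igr_inv : forall k, cell igr_carrier k -> cell igr_carrier k
}.
Arguments igr_one {i}.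
Arguments igr_mul {i k}.
Arguments igr_inv {i k}.

Definition delooping (K : internalGroup) : internalGpd := {|
  ig_mor := K;
  ig_ob := omega_terminal;
  src := fun _ _ => tt;
  tgt := fun _ _ => tt;
  iunit := fun k _ => igr_one k;
  icomp := fun k a b c => igr_mul a b = c;
  iinv := fun k a => igr_inv a |}.

Record filteredSpace := FilteredSpace {
  fs_space :> topologicalType;
  fs_filt : nat -> set fs_space;
  fs_incr : forall p, fs_filt p `<=` fs_filt p.+1
}.

HB.mixin Record isTopologicalGroup G & Group G & Topological G := {
  mulg_continuous : continuous (fun p : G * G => (p.1 * p.2)%g);
  invg_continuous : continuous (fun x : G => (x^-1)%g)
}.

#[short(type="topologicalGroupType")]
HB.structure Definition TopologicalGroup :=
  {G of Group G & Topological G & isTopologicalGroup G}.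

Record filteredTopGroup := FilteredTopGroup {
  ftg_group :> topologicalGroupType;
  ftg_filt : nat -> set ftg_group;
  ftg_one : forall p, ftg_filt p 1%g;
  ftg_mul : forall p x y, ftg_filt p x -> ftg_filt p y -> ftg_filt p (x * y)%g;
  ftg_inv : forall p x, ftg_filt p x -> ftg_filt p (x^-1)%g;
  ftg_incr : forall p, ftg_filt p `<=` ftg_filt p.+1;
  ftg_cover : \bigcup_p ftg_filt p = setT
}.

Definition ftg_space (G : filteredTopGroup) : filteredSpace :=
  FilteredSpace (@ftg_incr G).

Section interval.
Context (R : realType).

Definition unitI : topologicalType := set_type [set` `[0 : R, 1]].

Definition ival (t : unitI) : R := set_val t.

Lemma ival01 t : 0 <= ival t <= 1.
Proof. by have := set_valP t; rewrite /ival /= in_itv. Qed.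

Lemma ival_inj : injective ival.
Proof. by move=> s t; apply: val_inj. Qed.

Lemma clampI_subproof (x : R) : Num.max 0 (Num.min 1 x) \in [set` `[0 : R, 1]].
Proof.
by apply/mem_set; rewrite /= in_itv /= le_max lexx ge_max ler01 ge_min lexx.
Qed.

(* The retraction of the line onto the unit interval. *)
Definition clampI (x : R) : unitI := 
  @exist _ (fun x => x \in [set` `[0 : R, 1]]) _ (clampI_subproof x).

Lemma clampIE x : 0 <= x <= 1 -> ival (clampI x) = x.
Proof.
by case/andP=> x0 x1; rewrite /ival /clampI set_valE /= min_r // max_r.
Qed.

Lemma ivalK : cancel ival clampI.
Proof. by move=> t; apply: ival_inj; rewrite clampIE // ival01. Qed.

Definition endI (d : bool) : unitI := clampI d%:R.
Definition revI (t : unitI) : unitI := clampI (1 - ival t).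
Definition maxI (s t : unitI) : unitI := clampI (Num.max (ival s) (ival t)).
Definition fstHalf (t : unitI) : unitI := clampI (ival t * 2).
Definition sndHalf (t : unitI) : unitI := clampI (ival t * 2 - 1).

Definition innerI (t : unitI) : bool := 0 < ival t < 1.

Definition cube (k : nat) : topologicalType := prod_topology (fun _ : 'I_k => unitI).

(* The p-skeleton of the cube. *)
Definition cube_skel k (p : nat) : set (cube k) :=
  [set x | (#|[pred j | innerI (x j)]| <= p)%N].

Definition face_in k (i : 'I_k.+1) (d : bool) (x : cube k) : cube k.+1 :=
  fun j => if unlift i j is Some j' then x j' else endI d.

Definition degen_in k (i : 'I_k.+1) (x : cube k.+1) : cube k :=
  fun j => x (lift i j).

Definition conn_in k (i : 'I_k) (x : cube k.+1) : cube k :=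
  fun j => if j == i then maxI (x (wd i)) (x (up i)) else x (lift (up i) j).

Definition opp_in k (i : 'I_k) (x : cube k) : cube k :=
  dfwith x i (revI (x i)).

End interval.

Section continuity.
Context (R : realType).

Lemma continuous_compT (S T U : topologicalType) (f : S -> T) (g : T -> U) :
  continuous f -> continuous g -> continuous (fun x => g (f x)).
Proof. by move=> cf cg x; apply: continuous_comp; [exact: cf|exact: cg]. Qed.

Lemma pair_continuous (T U V : topologicalType) (f : T -> U) (g : T -> V) :
  continuous f -> continuous g -> continuous (fun x => (f x, g x)).
Proof. by move=> cf cg x; apply: cvg_pair; [exact: cf|exact: cg]. Qed.

Lemma fst_continuous (T U : topologicalType) : continuous (@fst T U).
Proof. by move=> x; exact: cvg_fst. Qed.

Lemma snd_continuous (T U : topologicalType) : continuous (@snd T U).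
Proof. by move=> x; exact: cvg_snd. Qed.

Lemma continuous_unitI (T : topologicalType) (f : T -> unitI R) :
  continuous (fun x => ival (f x)) -> continuous f.
Proof.
move=> cf; apply/continuousP => _ [B oB <-].
by have /continuousP/(_ _ oB) := cf.
Qed.

Lemma ival_continuous : continuous (@ival R).
Proof. exact: initial_continuous. Qed.

Lemma maxr_continuous (T : topologicalType) (f g : T -> R) :
  continuous f -> continuous g -> continuous (fun x => Num.max (f x) (g x)).
Proof. by move=> cf cg x; apply: continuous_max; [exact: cf|exact: cg]. Qed.

Lemma clampI_continuous : continuous (@clampI R).
Proof.
apply: continuous_unitI => x; rewrite /ival /clampI /=.
under eq_fun do rewrite set_valE /=.
apply: (@maxr_continuous R (fun=> 0)); first by move=> ?; exact: cvg_cst.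
by move=> y; apply: continuous_min; [exact: cvg_cst|exact: cvg_id].
Qed.

Lemma revI_continuous : continuous (@revI R).
Proof.
apply: (continuous_compT (f := fun t => 1 - ival t)); last exact: clampI_continuous.
move=> t; apply: (@cvgB R R _ (nbhs t) _ (fun=> 1)); first exact: cvg_cst.
exact: ival_continuous.
Qed.

Lemma fstHalf_continuous : continuous (@fstHalf R).
Proof.
apply: (continuous_compT (f := fun t => ival t * 2)); last exact: clampI_continuous.
by move=> t; apply: (@cvgM R _ (nbhs t) _ (@ival R)); [exact: ival_continuous|exact: cvg_cst].
Qed.

Lemma sndHalf_continuous : continuous (@sndHalf R).
Proof.
apply: (continuous_compT (f := fun t => ival t * 2 - 1)); last exact: clampI_continuous.
move=> t; apply: (@cvgB R R _ (nbhs t) _ (fun t => ival t * 2) (fun=> 1)).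
  by apply: (@cvgM R _ (nbhs t) _ (@ival R)); [exact: ival_continuous|exact: cvg_cst].
exact: cvg_cst.
Qed.

Lemma continuous_cube (T : topologicalType) n (f : T -> cube R n) :
  (forall j, continuous (fun x => f x j)) -> continuous f.
Proof.
move=> cf x; apply/cvg_sup => i U [_ [[W oW <-] WfN] WU].
apply: filterS WU _; apply: (cf i x W).
exact: open_nbhs_nbhs.
Qed.

Lemma cube_proj_continuous n (j : 'I_n) :
  continuous (fun x : cube R n => x j).
Proof. exact: (@proj_continuous _ (fun _ : 'I_n => unitI R) j). Qed.

Lemma continuous_if (T U : topologicalType) (h : T -> R) (f g : T -> U) (c : R) :
  continuous h -> continuous f -> continuous g ->
  (forall x, h x = c -> f x = g x) ->
  continuous (fun x => if h x <= c then f x else g x).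
Proof.
move=> ch cf cg fg; set k := (X in continuous X).
have clA : closed [set x | h x <= c].
  apply: (@preimage_closed _ _ h [set y | y <= c]) => [? _|]; first exact: ch.
  exact: closed_le.
have clB : closed [set x | c <= h x].
  apply: (@preimage_closed _ _ h [set y | c <= y]) => [? _|]; first exact: ch.
  exact: closed_ge.
apply/continuous_subspace_setT.
have -> : setT = [set x | h x <= c] `|` [set x | c <= h x].
  by apply/esym/seteqP; split => // x _ /=; apply/orP/le_total.
apply: withinU_continuous => //.
  apply: (@subspace_eq_continuous _ _ _ f); last exact: continuous_subspaceT.
  by move=> x /set_mem /= hx; rewrite /k /from_subspace hx.
apply: (@subspace_eq_continuous _ _ _ g); last exact: continuous_subspaceT.
move=> x /set_mem /= hx; rewrite /k /from_subspace; case: ifP => // hx'.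
by rewrite (fg x) //; apply/eqP; rewrite eq_le hx hx'.
Qed.

End continuity.

Section cube_maps.
Context (R : realType).
Local Notation cube := (cube R).

Lemma innerI_end d : innerI (endI R d) = false.
Proof.
rewrite /innerI clampIE; case: d => /=; by rewrite ?ltxx ?andbF ?lexx ?ler01.
Qed.

Lemma innerI_rev (t : unitI R) : innerI (revI t) = innerI t.
Proof.
have /andP[t0 t1] := ival01 t.
rewrite /innerI clampIE; last by rewrite subr_ge0 t1 lerBlDr lerDl.
by rewrite subr_gt0 ltrBlDr ltrDl andbC.
Qed.

Lemma innerI_max (s t : unitI R) : innerI (maxI s t) -> innerI s || innerI t.
Proof.
have /andP[s0 s1] := ival01 s; have /andP[t0 t1] := ival01 t.
rewrite /innerI /maxI; have [st|ts] := leP (ival s) (ival t).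
  by rewrite clampIE ?t0 // => ->; rewrite orbT.
by rewrite clampIE ?s0 // => ->.
Qed.

Lemma cube_skel_sub m n (f : 'I_m -> 'I_n) p (x : cube m) (y : cube n) :
  (forall j, innerI (y j) -> exists2 j', innerI (x j') & j = f j') ->
  cube_skel p x -> cube_skel p y.
Proof.
move=> fP; rewrite /cube_skel /=; apply: leq_trans.
apply: leq_trans (leq_image_card f [pred j | innerI (x j)]).
apply: subset_leq_card; apply/fintype.subsetP => j /fP[j' xj' ->].
exact: fintype.image_f.
Qed.

Lemma cube_skel_inj m n (g : 'I_n -> 'I_m) p (x : cube m) (y : cube n) :
  injective g -> (forall j, innerI (y j) -> innerI (x (g j))) ->
  cube_skel p x -> cube_skel p y.
Proof.
move=> gI gP; rewrite /cube_skel /=; apply: leq_trans.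
rewrite -(fintype.card_image gI); apply: subset_leq_card.
by apply/fintype.subsetP => _ /fintype.imageP[j /gP xj ->].
Qed.

Lemma cube_skelS p q k : (p <= q)%N -> @cube_skel R k p `<=` @cube_skel R k q.
Proof. by move=> pq x; rewrite /cube_skel /= => /leq_trans; apply. Qed.

(* Maps of cubes preserving the skeletal filtration. *)
Record cubeMap (m n : nat) := CubeMap {
  cm_fun :> cube m -> cube n;
  cm_cont : continuous cm_fun;
  cm_skel : forall p x, cube_skel p x -> cube_skel p (cm_fun x)
}.

Lemma face_in_cont k (i : 'I_k.+1) d : continuous (@face_in R k i d).
Proof.
apply: continuous_cube => j; rewrite /face_in.
by case: unliftP => [j' _|_]; [exact: cube_proj_continuous|exact: cst_continuous].
Qed.

Lemma face_in_skel k (i : 'I_k.+1) d p (x : cube k) :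
  cube_skel p x -> cube_skel p (face_in i d x).
Proof.
apply: (cube_skel_sub (f := lift i)) => j; rewrite /face_in.
by case: unliftP => [j' -> ? |_]; [exists j'|rewrite innerI_end].
Qed.

Definition face_map k (i : 'I_k.+1) d : cubeMap k k.+1 :=
  CubeMap (@face_in_cont k i d) (@face_in_skel k i d).

Lemma degen_in_cont k (i : 'I_k.+1) : continuous (@degen_in R k i).
Proof. by apply: continuous_cube => j; exact: cube_proj_continuous. Qed.

Lemma degen_in_skel k (i : 'I_k.+1) p (x : cube k.+1) :
  cube_skel p x -> cube_skel p (degen_in i x).
Proof. by apply: (cube_skel_inj (g := lift i)) => //; exact: lift_inj. Qed.

Definition degen_map k (i : 'I_k.+1) : cubeMap k.+1 k :=
  CubeMap (@degen_in_cont k i) (@degen_in_skel k i).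

Lemma conn_in_cont k (i : 'I_k) : continuous (@conn_in R k i).
Proof.
apply: continuous_cube => j; rewrite /conn_in.
case: eqP => _; last exact: cube_proj_continuous.
apply: continuous_compT; last exact: clampI_continuous.
by apply: maxr_continuous; apply: continuous_compT;
  [exact: cube_proj_continuous|exact: ival_continuous
  |exact: cube_proj_continuous|exact: ival_continuous].
Qed.

Lemma conn_in_skel k (i : 'I_k) p (x : cube k.+1) :
  cube_skel p x -> cube_skel p (conn_in i x).
Proof.
have wdE : wd i = lift (up i) i.
  by apply: val_inj; rewrite /= /bump /= add1n ltnn.
pose g j := if j == i then (if innerI (x (wd i)) then wd i else up i)
            else lift (up i) j.
apply: (cube_skel_inj (g := g)) => [j j'|j].
  rewrite /g wdE; case: eqP => [->|ne]; case: eqP => [->|ne'] //.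
  - by case: ifP => _ => [/lift_inj //|/eqP]; rewrite (negPf (neq_lift _ _)).
  - by case: ifP => _ => [/lift_inj //|/esym/eqP]; rewrite (negPf (neq_lift _ _)).
  - by move/lift_inj.
rewrite /g /conn_in; case: eqP => // _ /innerI_max.
by case: ifP.
Qed.

Definition conn_map k (i : 'I_k) : cubeMap k.+1 k :=
  CubeMap (@conn_in_cont k i) (@conn_in_skel k i).

Lemma opp_in_cont k (i : 'I_k) : continuous (@opp_in R k i).
Proof.
apply: continuous_cube => j; rewrite /opp_in.
have [->|ij] := eqVneq i j.
  under eq_fun do rewrite dfwithin.
  by apply: continuous_compT;
    [exact: cube_proj_continuous|exact: revI_continuous].
under eq_fun do rewrite dfwithout //.
exact: cube_proj_continuous.
Qed.

Lemma opp_in_skel k (i : 'I_k) p (x : cube k) :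
  cube_skel p x -> cube_skel p (opp_in i x).
Proof.
apply: (cube_skel_inj (g := id)) => // j; rewrite /opp_in.
by have [->|ij] := eqVneq i j; rewrite ?dfwithin ?innerI_rev // dfwithout.
Qed.

Definition opp_map k (i : 'I_k) : cubeMap k k :=
  CubeMap (@opp_in_cont k i) (@opp_in_skel k i).

End cube_maps.

Section rho.
Context (R : realType).
Implicit Types Y : filteredSpace.

Record filteredCube (Y : filteredSpace) (k : nat) := FilteredCube {
  fc_fun :> cube R k -> Y;
  fc_cont : continuous fc_fun;
  fc_filt : forall p x, cube_skel p x -> fs_filt p (fc_fun x)
}.
HB.instance Definition _ Y k := gen_eqMixin (filteredCube Y k).
HB.instance Definition _ Y k := gen_choiceMixin (filteredCube Y k).

Lemma filteredCubeP Y k (a b : filteredCube Y k) : a =1 b -> a = b.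
Proof.
case: a b => [a ca fa] [b cb fb] /= /funext ab; subst b.
by rewrite (Prop_irrelevance ca cb) (Prop_irrelevance fa fb).
Qed.

(* Filtered homotopy relative to the vertices. *)
Definition cube_homotopic Y k (a b : filteredCube Y k) : Prop :=
  exists H : cube R k * unitI R -> Y,
    [/\ continuous H,
        forall x, H (x, endI R false) = a x,
        forall x, H (x, endI R true) = b x,
        forall p x t, cube_skel p x -> fs_filt p (H (x, t)) &
        forall x t, cube_skel 0 x -> H (x, t) = a x].

Lemma cube_homotopic_refl Y k (a : filteredCube Y k) : cube_homotopic a a.
Proof.
exists (fun xt => a xt.1); split => //.
- by apply: continuous_compT; [exact: fst_continuous|exact: fc_cont].
- by move=> p x t; exact: fc_filt.
Qed.

Lemma revI_end d : revI (endI R d) = endI R (~~ d).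
Proof.
by rewrite /revI /endI clampIE; case: d => /=; rewrite ?subrr ?subr0 ?lexx ?ler01.
Qed.

Lemma cube_homotopic_sym Y k (a b : filteredCube Y k) :
  cube_homotopic a b -> cube_homotopic b a.
Proof.
case=> H [cH H0 H1 Hf Hv]; exists (fun xt => H (xt.1, revI xt.2)); split.
- apply: continuous_compT; last exact: cH.
  apply: pair_continuous; first exact: fst_continuous.
  by apply: continuous_compT; [exact: snd_continuous|exact: revI_continuous].
- by move=> x; rewrite revI_end H1.
- by move=> x; rewrite revI_end H0.
- by move=> p x t; exact: Hf.
- by move=> x t xv; rewrite Hv // -(Hv _ (endI R true) xv) H1.
Qed.

Lemma cube_homotopic_trans Y k (b a c : filteredCube Y k) :
  cube_homotopic a b -> cube_homotopic b c -> cube_homotopic a c.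
Proof.
case=> H [cH H0 H1 Hf Hv] [H' [cH' H'0 H'1 H'f H'v]].
have ivalE d : ival (endI R d) = d%:R.
  by rewrite clampIE //; case: d => /=; rewrite ?lexx ?ler01.
have h2 : 0 < 2 :> R by [].
exists (fun xt => if ival xt.2 <= 2^-1 then H (xt.1, fstHalf xt.2)
                  else H' (xt.1, sndHalf xt.2)); split.
- apply: (@continuous_if R _ _ (fun xt => ival xt.2)).
  + by apply: continuous_compT; [exact: snd_continuous|exact: ival_continuous].
  + apply: continuous_compT; last exact: cH.
    apply: pair_continuous; first exact: fst_continuous.
    by apply: continuous_compT; [exact: snd_continuous|exact: fstHalf_continuous].
  + apply: continuous_compT; last exact: cH'.
    apply: pair_continuous; first exact: fst_continuous.
    by apply: continuous_compT; [exact: snd_continuous|exact: sndHalf_continuous].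
  + move=> [x t] /= tE.
    rewrite /fstHalf /sndHalf tE mulVf ?lt0r_neq0 // subrr.
    by rewrite (H1 x) (H'0 x).
- move=> x /=; rewrite ivalE /= invr_ge0 ltW //.
  by rewrite /fstHalf ivalE mul0r H0.
- move=> x /=; rewrite ivalE /= leNgt invf_lt1 // ltr1n /=.
  by rewrite /sndHalf ivalE mul1r (_ : 2 - 1 = 1) ?H'1 // mulr2n addrK.
- by move=> p x t xp /=; case: ifP => _; [exact: Hf|exact: H'f].
- move=> x t xv /=; case: ifP => _; first exact: Hv.
  by rewrite H'v // -H1 Hv.
Qed.

Definition homotopic_rel Y k : rel (filteredCube Y k) :=
  fun a b => `[< cube_homotopic a b >].

Lemma homotopic_rel_refl Y k : reflexive (@homotopic_rel Y k).
Proof. by move=> a; apply/asboolP/cube_homotopic_refl. Qed.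

Lemma homotopic_rel_sym Y k : symmetric (@homotopic_rel Y k).
Proof.
by move=> a b; apply/asboolP/asboolP; exact: cube_homotopic_sym.
Qed.

Lemma homotopic_rel_trans Y k : transitive (@homotopic_rel Y k).
Proof.
move=> b a c /asboolP ab /asboolP bc; apply/asboolP.
exact: cube_homotopic_trans ab bc.
Qed.

Canonical homotopic_equiv Y k :=
  EquivRel (@homotopic_rel Y k) (@homotopic_rel_refl Y k)
    (@homotopic_rel_sym Y k) (@homotopic_rel_trans Y k).

(* Homotopy cubes; \pi a is the class of a. *)
Definition hcube Y k := {eq_quot (@homotopic_rel Y k)}.

Definition hclass Y k (a : filteredCube Y k) : hcube Y k := \pi a.

Lemma hclass_eq Y k (a b : filteredCube Y k) :
  hclass a = hclass b <-> cube_homotopic a b.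
Proof.
split; first by move/eqmodP => /= /asboolP.
by move=> ab; apply/eqmodP; apply/asboolP.
Qed.

Lemma precomp_cont Y m n (a : filteredCube Y n) (f : cubeMap R m n) :
  continuous (a \o f).
Proof. by apply: continuous_compT; [exact: cm_cont|exact: fc_cont]. Qed.

Lemma precomp_filt Y m n (a : filteredCube Y n) (f : cubeMap R m n) p x :
  cube_skel p x -> fs_filt p ((a \o f) x).
Proof. by move=> xp; apply/fc_filt/cm_skel. Qed.

Definition precomp Y m n (f : cubeMap R m n) (a : filteredCube Y n) :
    filteredCube Y m :=
  FilteredCube (@precomp_cont Y m n a f) (@precomp_filt Y m n a f).

Definition hprecomp Y m n (f : cubeMap R m n) (u : hcube Y n) : hcube Y m :=
  hclass (precomp f (repr u)).

Lemma hprecompE Y m n (f : cubeMap R m n) (a : filteredCube Y n) :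
  hprecomp f (hclass a) = hclass (precomp f a).
Proof.
apply/hclass_eq.
have [H [cH H0 H1 Hf Hv]] : cube_homotopic (repr (hclass a)) a.
  by apply/hclass_eq; rewrite /hclass reprK.
exists (fun xt => H (f xt.1, xt.2)); split => //=.
- apply: continuous_compT; last exact: cH.
  apply: pair_continuous; last exact: snd_continuous.
  by apply: continuous_compT; [exact: fst_continuous|exact: cm_cont].
- by move=> p x t xp; apply: Hf; exact: cm_skel.
- by move=> x t xv; apply: Hv; exact: cm_skel.
Qed.

(* c is the concatenation of a and b in direction i; the first conjunct says
   that the face of a at x_i = 1 is the face of b at x_i = 0. *)
Definition is_concat Y k (i : 'I_k) (a b c : filteredCube Y k) : Prop :=
  (forall x, a (dfwith x i (endI R true)) = b (dfwith x i (endI R false))) /\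
  (forall x, c x = if ival (x i) <= 2^-1 then a (dfwith x i (fstHalf (x i)))
                   else b (dfwith x i (sndHalf (x i)))).

Definition hcomp Y k (i : 'I_k) (u v w : hcube Y k) : Prop :=
  exists a b c, [/\ hclass a = u, hclass b = v, hclass c = w & is_concat i a b c].

Definition rho Y : omegaData := {|
  cell := hcube Y;
  face := fun k i d => hprecomp (face_map R i d);
  degen := fun k i => hprecomp (degen_map R i);
  conn := fun k i => hprecomp (conn_map R i);
  pcomp := @hcomp Y;
  opp := fun k i => hprecomp (opp_map R i) |}.

End rho.

Section rho_group.
Context (R : realType) (G : filteredTopGroup).
Local Notation fcube := (filteredCube R (ftg_space G)).

Lemma cube1_filt k p (x : cube R k) :
  cube_skel p x -> @fs_filt (ftg_space G) p 1%g.
Proof. by move=> _; exact: ftg_one. Qed.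

Definition cube1 k : fcube k :=
  @FilteredCube R (ftg_space G) k (fun=> 1%g)
    (@cst_continuous _ (ftg_space G) 1%g) (@cube1_filt k).

Lemma mul_continuous (T : topologicalType) (f g : T -> G) :
  continuous f -> continuous g -> continuous (fun x => (f x * g x)%g).
Proof.
move=> cf cg.
apply: (continuous_compT (f := fun x => (f x, g x))
                         (g := fun p : G * G => (p.1 * p.2)%g)).
  exact: pair_continuous.
exact: mulg_continuous.
Qed.

Lemma inv_continuous (T : topologicalType) (f : T -> G) :
  continuous f -> continuous (fun x => (f x)^-1%g).
Proof. by move=> cf; apply: (continuous_compT cf); exact: invg_continuous. Qed.

Lemma cubeM_filt k (a b : fcube k) p (x : cube R k) :
  cube_skel p x -> @fs_filt (ftg_space G) p (a x * b x : G)%g.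
Proof. by move=> xp; apply: ftg_mul; exact: (fc_filt _ xp). Qed.

Definition cubeM k (a b : fcube k) : fcube k :=
  @FilteredCube R (ftg_space G) k (fun x => (a x * b x : G)%g)
    (mul_continuous (@fc_cont _ _ _ a) (@fc_cont _ _ _ b)) (@cubeM_filt k a b).

Lemma cubeV_filt k (a : fcube k) p (x : cube R k) :
  cube_skel p x -> @fs_filt (ftg_space G) p ((a x : G)^-1)%g.
Proof. by move=> xp; apply: ftg_inv; exact: (fc_filt _ xp). Qed.

Definition cubeV k (a : fcube k) : fcube k :=
  @FilteredCube R (ftg_space G) k (fun x => ((a x : G)^-1)%g)
    (inv_continuous (@fc_cont _ _ _ a)) (@cubeV_filt k a).

Definition hone k : hcube R (ftg_space G) k := hclass (cube1 k).

Definition hmul k (u v : hcube R (ftg_space G) k) : hcube R (ftg_space G) k :=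
  hclass (cubeM (repr u) (repr v)).

Definition hinv k (u : hcube R (ftg_space G) k) : hcube R (ftg_space G) k :=
  hclass (cubeV (repr u)).

Lemma repr_homotopic k (a : fcube k) : cube_homotopic (repr (hclass a)) a.
Proof. by apply/hclass_eq; rewrite /hclass reprK. Qed.

Lemma hmulE k (a b : fcube k) : hmul (hclass a) (hclass b) = hclass (cubeM a b).
Proof.
apply/hclass_eq; have [H [cH H0 H1 Hf Hv]] := repr_homotopic a.
have [H' [cH' H'0 H'1 H'f H'v]] := repr_homotopic b.
exists (fun xt => (H xt * H' xt : G)%g); split => /=.
- exact: mul_continuous.
- by move=> x; rewrite H0 H'0.
- by move=> x; rewrite H1 H'1.
- by move=> p x t xp; apply: ftg_mul; [exact: Hf|exact: H'f].
- by move=> x t xv; rewrite Hv // H'v.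
Qed.

Lemma hinvE k (a : fcube k) : hinv (hclass a) = hclass (cubeV a).
Proof.
apply/hclass_eq; have [H [cH H0 H1 Hf Hv]] := repr_homotopic a.
exists (fun xt => ((H xt : G)^-1)%g); split => /=.
- exact: inv_continuous.
- by move=> x; rewrite H0.
- by move=> x; rewrite H1.
- by move=> p x t xp; apply: ftg_inv; exact: Hf.
- by move=> x t xv; rewrite Hv.
Qed.

Definition rho_group : internalGroup := {|
  igr_carrier := rho R (ftg_space G);
  igr_one := hone;
  igr_mul := hmul;
  igr_inv := hinv |}.

End rho_group.

Record monoMap (m n : nat) := MonoMap {
  mono_fun :> 'I_m.+1 -> 'I_n.+1;
  mono_homo : {homo mono_fun : i j / (i <= j)%N}
}.

Definition mono_id n : monoMap n n := @MonoMap n n id (fun _ _ h => h).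

Definition mono_comp l m n (g : monoMap m n) (f : monoMap l m) : monoMap l n :=
  @MonoMap l n (g \o f) (fun _ _ h => mono_homo g (mono_homo f h)).

Record simplicialSet := SimplicialSet {
  simp : nat -> Type;
  simp_map : forall m n, monoMap m n -> simp n -> simp m;
  simp_map_id : forall n (x : simp n), simp_map (mono_id n) x = x;
  simp_map_comp : forall l m n (g : monoMap m n) (f : monoMap l m) (x : simp n),
    simp_map (mono_comp g f) x = simp_map f (simp_map g x)
}.

Section realization.
Context (R : realType) (X : simplicialSet).

Definition std_simplex n : set (prod_topology (fun _ : 'I_n.+1 => R)) :=
  [set t | (forall i, 0 <= t i) /\ \sum_i t i = 1].

Arguments std_simplex : clear implicits.

Definition simplex n : topologicalType := set_type (std_simplex n).

Lemma simplex_push_subproof m n (f : monoMap m n) (t : simplex m) :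
  (fun j => \sum_(i | f i == j) set_val t i) \in std_simplex n.
Proof.
have [t0 t1] := set_valP t; apply/mem_set; split.
  by move=> j; apply: sumr_ge0 => i _; exact: t0.
by rewrite -t1 [RHS](partition_big f xpredT).
Qed.

Definition simplex_push m n (f : monoMap m n) (t : simplex m) : simplex n :=
  @exist _ (fun s => s \in std_simplex n) _ (simplex_push_subproof f t).

(* The disjoint union of a copy of the standard n-simplex for each n-simplex
   of X, with X discrete. *)
Definition simplex_index := {classic {n : nat & simp X n}}.
Definition pre_realization : topologicalType :=
  {s : simplex_index & simplex (tag (s : {n : nat & simp X n}))}.

Definition pre_point n (x : simp X n) (t : simplex n) : pre_realization :=
  existT (fun s : simplex_index => simplex (tag (s : {n : nat & simp X n})))
    (existT (simp X) n x) t.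

Inductive glued : pre_realization -> pre_realization -> Prop :=
  Glued m n (f : monoMap m n) (x : simp X n) (t : simplex m) :
    glued (pre_point (simp_map f x) t) (pre_point x (simplex_push f t)).

Definition glue_rel : rel pre_realization :=
  fun p q => `[< clos_refl_sym_trans _ glued p q >].

Lemma glue_rel_refl : reflexive glue_rel.
Proof. by move=> p; apply/asboolP; exact: rst_refl. Qed.

Lemma glue_rel_sym : symmetric glue_rel.
Proof. by move=> p q; apply/asboolP/asboolP; exact: rst_sym. Qed.

Lemma glue_rel_trans : transitive glue_rel.
Proof.
by move=> q p r /asboolP pq /asboolP qr; apply/asboolP; exact: rst_trans pq qr.
Qed.

Canonical glue_equiv :=
  EquivRel glue_rel glue_rel_refl glue_rel_sym glue_rel_trans.

Definition realization : topologicalType :=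
  quotient_topology {eq_quot glue_rel}.

Definition realization_skel (p : nat) : set realization :=
  [set y | exists n (x : simp X n) (t : simplex n),
     (n <= p)%N /\ y = \pi_{eq_quot glue_rel} (pre_point x t)].

Lemma realization_skelS p : realization_skel p `<=` realization_skel p.+1.
Proof. by move=> y [n [x [t [np ->]]]]; exists n, x, t; split=> //; exact: leqW. Qed.

Definition filtered_realization : filteredSpace :=
  FilteredSpace realization_skelS.

End realization.

Definition contractible (R : realType) (Y : topologicalType) : Prop :=
  exists (y0 : Y) (H : Y * unitI R -> Y),
    [/\ continuous H, forall y, H (y, endI R false) = y &
        forall y, H (y, endI R true) = y0].

Section gauge.
Context (R : realType) (X : simplicialSet) (G : filteredTopGroup).

Local Notation rhoX := (rho R (filtered_realization R X)).
Local Notation rhoG := (rho_group R G).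

Definition gaugeField := internalHom (P1 rhoX) (delooping rhoG).

Definition cellMap := forall n, cell rhoX n -> cell rhoG n.

(* Only the degrees n >= 1 of rho(|X|) occur in the second condition: it is
   stated for cells of degree n.+1. *)
Record is_gaugeTransf (A B : gaugeField) (u : cellMap) : Prop := {
  gt_hom : is_omegaHom u;
  gt_gauge : forall n (a : cell rhoX n.+1),
    igr_mul (igr_mul (u n (@src (P1 rhoX) n a)) (hom_mor A n a))
            (igr_inv (u n (@tgt (P1 rhoX) n a))) = hom_mor B n a
}.

Definition gaugeTransf (A B : gaugeField) := {u : cellMap | is_gaugeTransf A B u}.

(* By [gt_gauge], if u : A ~> B and v : B ~> C then
   C = v(s) B v(t)^-1 = (v u)(s) A (v u)(t)^-1, so that the composite A ~> C is
   [gt_mul v u]. *)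
Definition gt_mul (u v : cellMap) : cellMap := fun n a => igr_mul (u n a) (v n a).
Definition gt_one : cellMap := fun n _ => igr_one n.
Definition gt_inv (u : cellMap) : cellMap := fun n a => igr_inv (u n a).

End gauge.

(* Composition in diagrammatic order. *)
Record groupoidOn (Ob : Type) (Hom : Ob -> Ob -> Type) := GroupoidOn {
  gcomp : forall A B C, Hom A B -> Hom B C -> Hom A C;
  gid : forall A, Hom A A;
  ginv : forall A B, Hom A B -> Hom B A;
  gcompA : forall A B C D (f : Hom A B) (g : Hom B C) (h : Hom C D),
    gcomp f (gcomp g h) = gcomp (gcomp f g) h;
  gcomp1f : forall A B (f : Hom A B), gcomp (gid A) f = f;
  gcompf1 : forall A B (f : Hom A B), gcomp f (gid B) = f;
  gcompfV : forall A B (f : Hom A B), gcomp f (ginv f) = gid A;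
  gcompVf : forall A B (f : Hom A B), gcomp (ginv f) f = gid B
}.

(* Main.v *)
Require Import Defs.
From mathcomp Require Import all_boot all_order all_algebra.
From mathcomp Require Import all_classical all_reals all_analysis.

(** The group operations of rho(G) are computed pointwise on representatives,
    hence commute with precomposition by maps of cubes and, as a pointwise
    product of concatenations is the concatenation of the pointwise products,
    with the partial compositions.  So the morphisms into rho(G) form a group,
    and the gauge condition is stable under its operations by the group laws. *)

Set Implicit Arguments.
Unset Strict Implicit.
Unset Printing Implicit Defensive.

Section hcube_group.
Context (R : realType) (G : filteredTopGroup).
Local Notation hcubeG := (hcube R (ftg_space G)).
Local Notation fcubeG := (filteredCube R (ftg_space G)).

(** Choosing representatives makes [hmulE], [hinvE] and [hprecompE] applicable, so identities
    between classes reduce to pointwise identities in [G]. *)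
Lemma hclassP (Y : filteredSpace) k (u : hcube R Y k) :
  exists a : filteredCube R Y k, u = hclass a.
Proof. by exists (repr u); rewrite /hclass reprK. Qed.

Lemma hmulA k (u v w : hcubeG k) : hmul u (hmul v w) = hmul (hmul u v) w.
Proof.
have [[a ->] [b ->] [c ->]] := And3 (hclassP u) (hclassP v) (hclassP w).
by rewrite !hmulE; congr hclass; apply: filteredCubeP => x /=; exact: mulgA.
Qed.

Lemma hmul1u k (u : hcubeG k) : hmul (hone R G k) u = u.
Proof.
have [a ->] := hclassP u.
by rewrite hmulE; congr hclass; apply: filteredCubeP => x /=; exact: mul1g.
Qed.

Lemma hmulu1 k (u : hcubeG k) : hmul u (hone R G k) = u.
Proof.
have [a ->] := hclassP u.
by rewrite hmulE; congr hclass; apply: filteredCubeP => x /=; exact: mulg1.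
Qed.

Lemma hmulVu k (u : hcubeG k) : hmul (hinv u) u = hone R G k.
Proof.
have [a ->] := hclassP u.
rewrite hinvE hmulE; congr hclass; apply: filteredCubeP => x /=.
exact: mulVg.
Qed.

Lemma hmuluV k (u : hcubeG k) : hmul u (hinv u) = hone R G k.
Proof.
have [a ->] := hclassP u.
rewrite hinvE hmulE; congr hclass; apply: filteredCubeP => x /=.
exact: mulgV.
Qed.

(** v = (u^-1 u) v = u^-1 (u v) = u^-1. The remaining rules for inverses follow from this formally,
    without representatives. *)
Lemma hinv_unique k (u v : hcubeG k) : hmul u v = hone R G k -> v = hinv u.
Proof. by move=> uv1; rewrite -[LHS]hmul1u -(hmulVu u) -hmulA uv1 hmulu1. Qed.

Lemma hinvM k (u v : hcubeG k) : hinv (hmul u v) = hmul (hinv v) (hinv u).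
Proof.
apply/esym/hinv_unique.
by rewrite hmulA -(hmulA u) hmuluV hmulu1 hmuluV.
Qed.

Lemma hinvK k (u : hcubeG k) : hinv (hinv u) = u.
Proof. by apply/esym/hinv_unique; exact: hmulVu. Qed.

Lemma hinv1 k : hinv (hone R G k) = hone R G k.
Proof. by apply/esym/hinv_unique; exact: hmul1u. Qed.

(** Both sides are represented by x |-> a (f x) * b (f x). Faces, degeneracies, connections and
    inversions of [rho] are all of the form [hprecomp f], so this settles the four at once. *)
Lemma hprecompM m n (f : cubeMap R m n) (u v : hcubeG n) :
  hprecomp f (hmul u v) = hmul (hprecomp f u) (hprecomp f v).
Proof.
have [[a ->] [b ->]] := conj (hclassP u) (hclassP v).
rewrite !(hmulE, hprecompE); congr hclass.
exact: filteredCubeP.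
Qed.

Lemma hprecompV m n (f : cubeMap R m n) (u : hcubeG n) :
  hprecomp f (hinv u) = hinv (hprecomp f u).
Proof.
have [a ->] := hclassP u.
by rewrite !(hinvE, hprecompE); congr hclass; exact: filteredCubeP.
Qed.

Lemma hprecomp1 m n (f : cubeMap R m n) :
  hprecomp f (hone R G n) = hone R G m.
Proof. by rewrite hprecompE; congr hclass; exact: filteredCubeP. Qed.

(** Interchange of the group product with +_i. The face condition in [is_concat] is a strict
    equality of maps, not one up to homotopy, so it can be multiplied pointwise. *)
Lemma hcompM k (i : 'I_k) (u v w u' v' w' : hcubeG k) :
  hcomp i u v w -> hcomp i u' v' w' ->
  hcomp i (hmul u u') (hmul v v') (hmul w w').
Proof.
move=> [a [b [c [<- <- <- [ab cE]]]]] [a' [b' [c' [<- <- <- [ab' cE']]]]].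
exists (cubeM a a'), (cubeM b b'), (cubeM c c'); rewrite !hmulE.
split=> //; split=> x /=; first by rewrite ab ab'.
(* Both concatenations branch on the same test on x_i, whatever the representatives. *)
by rewrite cE cE'; case: ifP.
Qed.

(** Inversion in [G] acts by postcomposition, which commutes with concatenation; hence the order of
    u and v is kept although inversion reverses products. *)
Lemma hcompV k (i : 'I_k) (u v w : hcubeG k) :
  hcomp i u v w -> hcomp i (hinv u) (hinv v) (hinv w).
Proof.
move=> [a [b [c [<- <- <- [ab cE]]]]].
exists (cubeV a), (cubeV b), (cubeV c); rewrite !hinvE.
split=> //; split=> x /=; first by rewrite ab.
by rewrite cE; case: ifP.
Qed.

Lemma hcomp1 k (i : 'I_k) : hcomp i (hone R G k) (hone R G k) (hone R G k).
Proof.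
exists (cube1 R G k), (cube1 R G k), (cube1 R G k).
by split=> //; split=> x //=; case: ifP.
Qed.

End hcube_group.

Section hom_group.
Context (R : realType) (G : filteredTopGroup) (K : omegaData).
Local Notation rhoG := (rho_group R G).
Implicit Types f g : forall k, cell K k -> cell rhoG k.

Lemma is_omegaHom_mul f g : is_omegaHom f -> is_omegaHom g ->
  @is_omegaHom K rhoG (fun k x => igr_mul (f k x) (g k x)).
Proof.
move=> [fF fD fC fM fV] [gF gD gC gM gV]; split=> [k i d x|k i x|k i x|k i a b c|k i x] /=.
- by rewrite hprecompM fF gF.
- by rewrite hprecompM fD gD.
- by rewrite hprecompM fC gC.
- by move=> abc; apply: hcompM; [exact: fM|exact: gM].
- by rewrite hprecompM fV gV.
Qed.

Lemma is_omegaHom_inv f : is_omegaHom f ->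
  @is_omegaHom K rhoG (fun k x => igr_inv (f k x)).
Proof.
move=> [fF fD fC fM fV]; split=> [k i d x|k i x|k i x|k i a b c|k i x] /=.
- by rewrite hprecompV fF.
- by rewrite hprecompV fD.
- by rewrite hprecompV fC.
- by move=> abc; apply: hcompV; exact: fM.
- by rewrite hprecompV fV.
Qed.

Lemma is_omegaHom_one : @is_omegaHom K rhoG (fun k _ => igr_one k).
Proof.
by split=> * /=; rewrite ?hprecomp1 //; exact: hcomp1.
Qed.

End hom_group.

Section gauge_transformations.
Context (R : realType) (X : simplicialSet) (G : filteredTopGroup).
Implicit Types (A B C : gaugeField R X G) (u v w : cellMap R X G).

Lemma is_gaugeTransf_mul A B C u v :
  is_gaugeTransf A B u -> is_gaugeTransf B C v ->
  is_gaugeTransf A C (gt_mul v u).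
Proof.
move=> [uH uG] [vH vG]; split; first exact: is_omegaHom_mul.
(* C = v(s) (u(s) A u(t)^-1) v(t)^-1, and [hinvM] identifies u(t)^-1 v(t)^-1 with (v u)(t)^-1. *)
by move=> n a; rewrite -vG -uG /gt_mul /= hinvM !hmulA.
Qed.

Lemma is_gaugeTransf_one A : is_gaugeTransf A A (@gt_one R X G).
Proof.
split; first exact: is_omegaHom_one.
by move=> n a; rewrite /gt_one /= hinv1 hmul1u hmulu1.
Qed.

Lemma is_gaugeTransf_inv A B u :
  is_gaugeTransf A B u -> is_gaugeTransf B A (gt_inv u).
Proof.
move=> [uH uG]; split; first exact: is_omegaHom_inv.
(* Conjugating back: u(s)^-1 u(s) cancels on the left, then u(t)^-1 u(t) on the right, where [hinvK]
   has turned the double inverse into u(t). *)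
move=> n a; rewrite -uG /gt_inv /= hinvK !hmulA hmulVu hmul1u.
by rewrite -hmulA hmulVu hmulu1.
Qed.

Lemma cellMapP u v : (forall n a, u n a = v n a) -> u = v.
Proof. by move=> uv; apply: functional_extensionality_dep => n; exact/funext. Qed.

Lemma gt_mulA u v w : gt_mul u (gt_mul v w) = gt_mul (gt_mul u v) w.
Proof. by apply: cellMapP => n a; exact: hmulA. Qed.

Lemma gt_mul1u u : gt_mul (@gt_one R X G) u = u.
Proof. by apply: cellMapP => n a; exact: hmul1u. Qed.

Lemma gt_mulu1 u : gt_mul u (@gt_one R X G) = u.
Proof. by apply: cellMapP => n a; exact: hmulu1. Qed.

Lemma gt_muluV u : gt_mul u (gt_inv u) = @gt_one R X G.
Proof. by apply: cellMapP => n a; exact: hmuluV. Qed.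

Lemma gt_mulVu u : gt_mul (gt_inv u) u = @gt_one R X G.
Proof. by apply: cellMapP => n a; exact: hmulVu. Qed.

(** Proof irrelevance of [is_gaugeTransf] reduces the groupoid laws to the group laws of
    [cellMap]. *)
Lemma gaugeTransfP A B (s t : gaugeTransf A B) :
  proj1_sig s = proj1_sig t -> s = t.
Proof. by case: s t => [u uP] [v vP] /=; exact: eq_exist. Qed.

(** Kept transparent so that the underlying map of a composite is a [gt_mul] by computation. *)
Definition gaugeGroupoid : groupoidOn (@gaugeTransf R X G).
Proof.
refine (@GroupoidOn _ (@gaugeTransf R X G)
  (fun A B C s t => exist _ (gt_mul (proj1_sig t) (proj1_sig s))
     (is_gaugeTransf_mul (proj2_sig s) (proj2_sig t)))
  (fun A => exist _ (@gt_one R X G) (is_gaugeTransf_one A))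
  (fun A B s => exist _ (gt_inv (proj1_sig s)) (is_gaugeTransf_inv (proj2_sig s)))
  _ _ _ _ _) => *; apply: gaugeTransfP => /=.
(* The composite of s followed by t is [gt_mul t s], so left and right laws trade places below. *)
- by rewrite gt_mulA.
- exact: gt_mulu1.
- exact: gt_mul1u.
- exact: gt_mulVu.
- exact: gt_muluV.
Defined.

End gauge_transformations.

Unset Implicit Arguments.
Set Strict Implicit.

Theorem mainTheorem5 (R : realType) (X : simplicialSet) (G : filteredTopGroup)
    (X_contractible : contractible R (realization R X)) :
  [/\ forall (A B C : gaugeField R X G) (u v : cellMap R X G),
        is_gaugeTransf A B u -> is_gaugeTransf B C v ->
        is_gaugeTransf A C (gt_mul v u),
      forall A : gaugeField R X G, is_gaugeTransf A A (@gt_one R X G),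
      forall (A B : gaugeField R X G) (u : cellMap R X G),
        is_gaugeTransf A B u ->
        [/\ is_gaugeTransf B A (gt_inv u),
            gt_mul u (gt_inv u) = @gt_one R X G &
            gt_mul (gt_inv u) u = @gt_one R X G] &
      exists Gpd : groupoidOn (@gaugeTransf R X G),
        forall (A B C : gaugeField R X G)
          (u : gaugeTransf A B) (v : gaugeTransf B C),
          proj1_sig (gcomp Gpd u v) = gt_mul (proj1_sig v) (proj1_sig u)].
Proof.
split.
- by move=> A B C u v; exact: is_gaugeTransf_mul.
- exact: is_gaugeTransf_one.
- move=> A B u uAB; split; first exact: is_gaugeTransf_inv.
  + exact: gt_muluV.
  + exact: gt_mulVu.
- by exists (gaugeGroupoid R X G).
Qed.
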